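(* Let $p>3$ be a prime and $q=p^r$, $r\geq 1$, such that $q\not\equiv 1\pmod 3$. For $t\in\mathbb{F}_q$, $t\neq 0,1$, consider the Hessian curve $C_t: x^3+y^3+1=3txy$ over $\mathbb{F}_q$, and let $\#C_t(\mathbb{F}_q)$ denote the number of $\mathbb{F}_q$-points on it, i.e. the number of $(x,y)\in\mathbb{F}_q^2$ with $x^3+y^3+1=3txy$. Then $$\sum_{t\in\mathbb{F}_q^\times,\ t\neq 1}\varphi(t(t^3-1))\,\#C_t(\mathbb{F}_q)=1.$$
   Context: $\varphi$ is the quadratic character on $\mathbb{F}_q$ (with $\varphi(0)=0$). *)

(* Defs.v *)
From mathcomp Require Import all_boot all_order all_algebra.

Set Implicit Arguments.
Unset Strict Implicit.
Unset Printing Implicit Defensive.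

Import GRing.Theory.
Local Open Scope ring_scope.

(* The quadratic character, with values in int; in odd characteristic it is
   the multiplicative character of order 2, extended by 0 at 0. *)
Definition quad_char (F : finFieldType) (a : F) : int :=
  if a == 0 then 0
  else if [exists b : F, b ^+ 2 == a] then 1
  else -1.

(* Affine points only: points at infinity of the projective closure are not
   included. *)
Definition hessian_points (F : finFieldType) (t : F) : {set F * F} :=
  [set P : F * F | P.1 ^+ 3 + P.2 ^+ 3 + 1 == 3%:R * t * P.1 * P.2].

(* Main.v *)
Require Import Defs.
From mathcomp Require Import all_boot all_order all_algebra all_field.
From mathcomp Require Import ring zify.

Import GRing.Theory.
Local Open Scope ring_scope.

(** Interchanging the two summations turns the sum into one over points
    [(x, y)] of the plane: each point contributes the sum of
    [phi (t * (t ^+ 3 - 1))] over the [t] whose curve contains it.  If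
    [x * y != 0] there is exactly one such [t], namely [s / (3 * x * y)] with
    [s = x ^+ 3 + y ^+ 3 + 1], and clearing a fourth power of [3 * x * y]
    makes the contribution [phi (s * (s ^+ 3 - 27 * x ^+ 3 * y ^+ 3))].  If
    [x * y = 0], either no [t] or every [t] occurs, and since
    [phi (t * (t ^+ 3 - 1))] sums to -1 over the field, the contribution is
    the same expression minus 1 ([sum_quad_char_through_point]).  The lines
    [x * y = 0] have [2q - 1] points, so what remains is to see that the
    expression sums to [2q] over the whole plane ([sum_quad_char_plane]).

    As [q] is 2 modulo 3, cubing permutes the field and [x ^+ 3], [y ^+ 3] may
    be replaced by free variables [a], [b].  For a fixed [s = a + b + 1] the
    sum over [a] is that of [phi] over the values of a quadratic polynomial,
    which depends only on whether its discriminant vanishes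
    ([sum_quad_char_quadratic]).  The discriminant is
    [- 27 * (s - 3) ^+ 2 * (4 * s - 3)], so the generic terms add up to a
    multiple of [\sum_s phi s = 0] while [s = 3] and [s = 3 / 4] contribute
    an extra [q] each. *)

(** * Sums of indicators *)

Lemma sum_indicator (T : finType) (c : T) (g : T -> int) :
  \sum_x (x == c)%:R * g x = g c.
Proof.
rewrite (bigD1 c) //= eqxx mul1r big1 ?addr0 // => x /negPf->.
by rewrite mul0r.
Qed.

Lemma sum_indicator1 (T : finType) (c : T) : \sum_x (x == c)%:R = 1%R :> int.
Proof.
rewrite -[RHS](sum_indicator T c (fun=> 1)).
by apply: eq_bigr => x _; rewrite mulr1.
Qed.

Lemma sum_const_card (T : finType) (c : int) : \sum_(x : T) c = #|T|%:R * c.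
Proof. by rewrite sumr_const mulr_natl. Qed.

Lemma sum_axes (F : finFieldType) :
  \sum_(x : F) \sum_(y : F) (x * y == 0)%:R = (2 * #|F|%:R - 1)%R :> int.
Proof.
have row (x : F) :
    \sum_y (x * y == 0)%:R = (1 + (x == 0)%:R * (#|F|%:R - 1))%R :> int.
  have [->|x0] := eqVneq x 0.
    under eq_bigr do rewrite mul0r eqxx.
    by rewrite sum_const_card /=; ring.
  rewrite mul0r addr0 -[RHS](sum_indicator1 F 0).
  by apply: eq_bigr => y _; rewrite mulf_eq0 (negPf x0).
under eq_bigr do rewrite row.
by rewrite big_split /= sum_const_card sum_indicator; ring.
Qed.

(** * The quadratic character *)

Section QuadraticCharacter.

Variable F : finFieldType.
Hypothesis two_neq0 : 2%:R != 0 :> F.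
Local Notation q := (#|F|%:R : int).
Implicit Types a b c d s x y : F.

Lemma quad_char0 : quad_char (0 : F) = 0.
Proof. by rewrite /quad_char eqxx. Qed.

Lemma quad_char_sqr a : a != 0 -> quad_char (a ^+ 2) = 1.
Proof.
move=> a0; rewrite /quad_char expf_eq0 /= (negPf a0).
by case: existsP => // -[]; exists a.
Qed.

(** Square roots come in pairs [b, - b]; this identity is how character sums
    are turned into point counts and back. *)
Lemma sum_sqrt_indicator a : \sum_y (y ^+ 2 == a)%:R = 1 + quad_char a.
Proof.
rewrite /quad_char; have [->|a0] := eqVneq.
  rewrite addr0 -[RHS](sum_indicator1 F 0); apply: eq_bigr => y _.
  by rewrite expf_eq0.
case: existsP => [[b /eqP def_a]|nsq].
  have b0 : b != 0 by apply: contra_neq a0 => b0; rewrite -def_a b0 expr0n.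
  have bNb : b != - b.
    by rewrite -subr_eq0 opprK -mulr2n -mulr_natl mulf_neq0.
  transitivity (\sum_y ((y == b)%:R + (y == - b)%:R) : int).
    apply: eq_bigr => y _; rewrite -def_a eqf_sqr.
    by have [->|] := eqVneq y b; rewrite ?(negPf bNb) ?addr0 ?add0r.
  by rewrite big_split /= !sum_indicator1.
rewrite subrr big1 // => y _; case: eqP => // /eqP ya.
by case: nsq; exists y.
Qed.

Lemma sum_quad_char : \sum_a quad_char (a : F) = 0.
Proof.
apply: (@addrI _ q); rewrite addr0 -{1}[q]mulr1 -sum_const_card -big_split /=.
under eq_bigr do rewrite -sum_sqrt_indicator.
rewrite exchange_big /= -[RHS]mulr1 -sum_const_card; apply: eq_bigr => y _.
rewrite -[RHS](sum_indicator1 F (y ^+ 2)).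
by apply: eq_bigr => a _; rewrite eq_sym.
Qed.

Lemma quad_char_sqrM a b : a != 0 -> quad_char (a ^+ 2 * b) = quad_char b.
Proof.
move=> a0; rewrite /quad_char mulf_eq0 expf_eq0 /= (negPf a0) /=.
case: eqP => // _; congr (if _ then _ else _).
apply/existsP/existsP => -[c /eqP e].
  by exists (c / a); rewrite expr_div_n e mulrC mulKf // expf_neq0.
by exists (a * c); rewrite exprMn e.
Qed.

Lemma quad_charP c :
  [\/ c = 0 /\ quad_char c = 0,
      exists2 b, b != 0 & c = b ^+ 2 /\ quad_char c = 1
    | c != 0 /\ quad_char c = -1].
Proof.
have [->|c0] := eqVneq c 0; first by constructor 1; rewrite quad_char0.
rewrite /quad_char (negPf c0).
case: existsP => [[b /eqP e]|]; last by constructor 3.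
constructor 2; exists b => //.
by apply: contra_neq c0 => b0; rewrite -e b0 expr0n.
Qed.

(** The only delicate case is that of two non-squares [a] and [b].  Both
    [quad_char] and its translate [x |-> quad_char (a * x)] sum to zero, and
    their sum is nowhere positive: it is [1 - 1] at nonzero squares, because
    [a] is not a square, and at most [-1 + 1] at non-squares.  So it vanishes
    everywhere, in particular at [b]. *)
Lemma quad_charM a b : quad_char (a * b) = quad_char a * quad_char b.
Proof.
case: (quad_charP a) => [[-> ->]|[d d0 [-> ->]]|[a0 qa]].
- by rewrite !mul0r quad_char0.
- by rewrite quad_char_sqrM // mul1r.
have le0 x : 0 <= - (quad_char x + quad_char (a * x)).
  case: (quad_charP x) => [[-> ->]|[d d0 [-> ->]]|[x0 ->]].
  - by rewrite mulr0 quad_char0.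
  - by rewrite mulrC quad_char_sqrM // qa.
  - by case: (quad_charP (a * x)) => [[_ ->]|[d _ [_ ->]]|[_ ->]].
have sum0 : \sum_x - (quad_char x + quad_char (a * x)) = 0.
  rewrite sumrN big_split /= sum_quad_char add0r.
  rewrite -(reindex_inj (P := predT) (F := @quad_char F) (mulfI a0)).
  by rewrite sum_quad_char oppr0.
have /eqP := Num.Theory.psumr_eq0P (fun x _ => le0 x) sum0 (i := b) isT.
by rewrite oppr_eq0 addrC addr_eq0 qa mulN1r => /eqP.
Qed.

(** Replace [quad_char] by a count of square roots [y = x - u]: the equation
    [y ^+ 2 = x ^+ 2 - d] becomes [2 * u * x = u ^+ 2 + d], which is linear in
    [x]. *)
Lemma sum_quad_char_sqrB d :
  \sum_x quad_char (x ^+ 2 - d) = q * (d == 0)%:R - 1.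
Proof.
have count : \sum_x \sum_y (y ^+ 2 == x ^+ 2 - d)%:R
             = (q * (d == 0)%:R + (q - 1))%R :> int.
  transitivity (\sum_u \sum_x ((u * (2%:R * x) == u ^+ 2 + d)%:R : int)).
    rewrite [RHS]exchange_big /=; apply: eq_bigr => x _.
    rewrite (reindex_inj (h := fun u => x - u)); last first.
      by move=> u v /addrI /oppr_inj.
    apply: eq_bigr => u _; congr (_%:R); congr (nat_of_bool _).
    rewrite -subr_eq0 -[RHS]subr_eq0 -[RHS]oppr_eq0; congr (_ == 0); ring.
  have col u : \sum_x (u * (2%:R * x) == u ^+ 2 + d)%:R
       = (1 + (u == 0)%:R * (q * (d == 0)%:R - 1))%R :> int.
    have [->|u0] := eqVneq u 0.
      under eq_bigr do rewrite mul0r expr0n add0r eq_sym.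
      by rewrite sum_const_card /=; ring.
    rewrite mul0r addr0 -[RHS](sum_indicator1 F ((u ^+ 2 + d) / (u * 2%:R))).
    apply: eq_bigr => x _; congr (_%:R); congr (nat_of_bool _).
    rewrite mulrA [u * _ * x]mulrC.
    by rewrite (can2_eq (mulfK _) (divfK _)) // mulf_neq0.
  under eq_bigr do rewrite col.
  by rewrite big_split /= sum_const_card sum_indicator; ring.
move: count; under eq_bigr do rewrite sum_sqrt_indicator.
rewrite big_split /= sum_const_card mulr1 => e.
by apply: (@addrI _ q); rewrite e; ring.
Qed.

(** Completing the square: [4 * a] times the polynomial is
    [(2 * a * x + b) ^+ 2] minus the discriminant. *)
Lemma sum_quad_char_quadratic a b c : a != 0 ->
  \sum_x quad_char (a * x ^+ 2 + b * x + c)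
  = quad_char a * (q * (b ^+ 2 - 4%:R * a * c == 0)%:R - 1).
Proof.
move=> a0; rewrite -sum_quad_char_sqrB mulr_sumr.
have a2 : 2%:R * a != 0 by rewrite mulf_neq0.
rewrite [RHS](reindex_inj (h := fun x => 2%:R * a * x + b)); last first.
  by move=> x y /addIr /(mulfI a2).
apply: eq_bigr => x _; rewrite -quad_charM -(quad_char_sqrM (2%:R * a)) //.
have -> : a * ((2%:R * a * x + b) ^+ 2 - (b ^+ 2 - 4%:R * a * c))
  = (2%:R * a) ^+ 2 * (a * x ^+ 2 + b * x + c) by ring.
by [].
Qed.

End QuadraticCharacter.

(** * The sum over the plane *)

Section HessianSum.

Variable F : finFieldType.
Hypothesis two_neq0 : 2%:R != 0 :> F.
Hypothesis three_neq0 : 3%:R != 0 :> F.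
Hypothesis cube_inj : injective (fun x : F => x ^+ 3).
Local Notation q := (#|F|%:R : int).
Implicit Types a b s t x y : F.

Local Notation phi_quartic t := (quad_char (t * (t ^+ 3 - 1))).

Local Notation plane_term a b :=
  (quad_char ((a + b + 1) * ((a + b + 1) ^+ 3 - 27%:R * a * b))).

Let four_neq0 : 4%:R != 0 :> F.
Proof. by rewrite (natrM _ 2 2) mulf_neq0. Qed.

Let twenty_seven_neq0 : 27%:R != 0 :> F.
Proof. by rewrite (natrX _ 3 3) expf_neq0. Qed.

(** Substituting [1 / t] for [t] turns the quartic into the cubic [1 - t ^+ 3],
    up to a square. *)
Lemma sum_quad_char_quartic : \sum_(t : F) phi_quartic t = -1.
Proof.
rewrite (bigD1 0) //= mul0r quad_char0 add0r (reindex_inj (@invr_inj F)) /=.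
transitivity (\sum_(t : F | t != 0) quad_char (1 - t ^+ 3)).
  apply: eq_big => [t|t]; rewrite invr_eq0 // => t0.
  rewrite -(quad_char_sqrM F (t ^- 2) (1 - _)) ?invr_eq0 ?expf_neq0 //.
  by congr quad_char; field.
have : \sum_(t : F) quad_char (1 - t ^+ 3) = 0.
  rewrite -(reindex_inj (P := predT) (F := fun u => quad_char (1 - u)) cube_inj).
  rewrite -[RHS](sum_quad_char F two_neq0).
  rewrite [RHS](reindex_inj (h := fun u => 1 - u)) //.
  by move=> u v /addrI /oppr_inj.
rewrite (bigD1 0) //= expr0n subr0 -(expr1n F 2) quad_char_sqr ?oner_neq0 //.
by move=> /eqP; rewrite expr1n addrC addr_eq0 => /eqP.
Qed.

(** Off the axes the only [t] is [s / (3 * x * y)], with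
    [s = x ^+ 3 + y ^+ 3 + 1].  On them the condition does not involve [t]. *)
Lemma sum_quad_char_through_point x y :
  \sum_(t : F) phi_quartic t * (x ^+ 3 + y ^+ 3 + 1 == 3%:R * t * x * y)%:R
  = plane_term (x ^+ 3) (y ^+ 3) - (x * y == 0)%:R.
Proof.
set s := x ^+ 3 + y ^+ 3 + 1.
have [xy0|xy_neq0] := eqVneq (x * y) 0.
  have -> : s * (s ^+ 3 - 27%:R * x ^+ 3 * y ^+ 3) = (s ^+ 2) ^+ 2.
    have -> : 27%:R * x ^+ 3 * y ^+ 3 = 27%:R * (x * y) ^+ 3 by ring.
    by rewrite xy0; ring.
  under eq_bigr do rewrite -mulrA xy0 mulr0.
  rewrite -mulr_suml sum_quad_char_quartic.
  have [->|s0] := eqVneq s 0; first by rewrite !expr0n quad_char0.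
  by rewrite quad_char_sqr ?expf_neq0.
rewrite subr0; set m := 3%:R * (x * y).
have m0 : m != 0 by rewrite mulf_neq0.
transitivity (\sum_(t : F) (t == s / m)%:R * phi_quartic t).
  apply: eq_bigr => t _; rewrite mulrC; congr (_%:R * _); congr (nat_of_bool _).
  rewrite -(can2_eq (mulfK m0) (divfK m0)) eq_sym; congr (_ == _).
  by rewrite /m; ring.
rewrite sum_indicator -(quad_char_sqrM F (m ^+ 2)) ?expf_neq0 //.
have -> : 27%:R * x ^+ 3 * y ^+ 3 = m ^+ 3 by rewrite /m; ring.
by congr quad_char; field.
Qed.

(** The fiber of the plane over [s = a + b + 1], parametrized by [a]: the
    argument is [s] times a quadratic polynomial in [a], whose discriminant is
    [- 27 * (s - 3) ^+ 2 * (4 * s - 3)]. *)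
Lemma sum_plane_term_fiber s :
  \sum_(a : F) quad_char (s * (s ^+ 3 - 27%:R * a * (s - 1 - a)))
  = quad_char s * quad_char (27%:R : F)
    * (q * ((s == 3%:R)%:R + (s == 3%:R / 4%:R)%:R) - 1).
Proof.
transitivity (quad_char s * \sum_(a : F) quad_char
    (27%:R * a ^+ 2 + (27%:R * (1 - s)) * a + s ^+ 3)).
  rewrite mulr_sumr; apply: eq_bigr => a _.
  by rewrite -quad_charM //; congr quad_char; ring.
rewrite sum_quad_char_quadratic // mulrA; congr (_ * (_ * _ - _)).
have -> : (27%:R * (1 - s)) ^+ 2 - 4%:R * 27%:R * s ^+ 3
    = - 27%:R * ((s - 3%:R) ^+ 2 * (s * 4%:R - 3%:R)) by ring.
rewrite mulf_eq0 oppr_eq0 (negPf twenty_seven_neq0) /= mulf_eq0 expf_eq0 /=.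
rewrite !subr_eq0 (can2_eq (mulfK four_neq0) (divfK four_neq0)).
have [->|//] := eqVneq s 3%:R; last by rewrite add0r.
(* The two roots of the discriminant differ, as [4 * 3 - 3 = 3 ^+ 2]. *)
rewrite -(can2_eq (mulfK four_neq0) (divfK four_neq0)) -subr_eq0.
have -> : 3%:R * 4%:R - 3%:R = 3%:R ^+ 2 :> F by ring.
by rewrite expf_eq0 /= (negPf three_neq0).
Qed.

(** The terms common to all fibers cancel, and those over [3] and [3 / 4] each
    have an extra [q], since [3 * 27] and [3 / 4 * 27] are squares. *)
Lemma sum_quad_char_plane :
  \sum_(x : F) \sum_(y : F) plane_term (x ^+ 3) (y ^+ 3) = 2 * q.
Proof.
transitivity (\sum_(a : F) \sum_(b : F) plane_term a b).
  rewrite [RHS](reindex_inj cube_inj); apply: eq_bigr => x _.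
  by rewrite [RHS](reindex_inj cube_inj).
transitivity (\sum_(s : F) \sum_(a : F)
    quad_char (s * (s ^+ 3 - 27%:R * a * (s - 1 - a)))).
  rewrite [RHS]exchange_big /=; apply: eq_bigr => a _.
  rewrite (reindex_inj (h := fun s => s - 1 - a)); last first.
    by move=> s t /addIr /addIr.
  apply: eq_bigr => s _.
  by have -> : a + (s - 1 - a) + 1 = s by ring.
under eq_bigr do rewrite sum_plane_term_fiber.
pose c := quad_char (27%:R : F).
transitivity (\sum_(s : F) ((s == 3%:R)%:R * (q * (quad_char s * c))
   + (s == 3%:R / 4%:R)%:R * (q * (quad_char s * c)) + quad_char s * - c)).
  by apply: eq_bigr => s _; rewrite /c; ring.
rewrite !big_split /= -mulr_suml sum_quad_char // !sum_indicator.
rewrite -!quad_charM //.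
have -> : 3%:R * 27%:R = (3%:R ^+ 2) ^+ 2 :> F by ring.
have -> : 3%:R / 4%:R * 27%:R = (3%:R ^+ 2 / 2%:R) ^+ 2 :> F.
  by field; rewrite four_neq0 two_neq0.
rewrite !quad_char_sqr ?mulf_neq0 ?invr_eq0 ?expf_neq0 //.
by ring.
Qed.

Lemma sum_quad_char_hessian :
  \sum_(t : F) phi_quartic t * #|hessian_points t|%:R = 1.
Proof.
have cardE t : #|hessian_points t|%:R
    = \sum_x \sum_y (x ^+ 3 + y ^+ 3 + 1 == 3%:R * t * x * y)%:R :> int.
  rewrite pair_big /= -sum1_card natr_sum big_mkcond /=.
  by apply: eq_bigr => P _; rewrite inE; case: ifP.
under eq_bigr do rewrite cardE mulr_sumr.
rewrite exchange_big /=.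
transitivity (\sum_(x : F) \sum_(y : F)
    (plane_term (x ^+ 3) (y ^+ 3) - (x * y == 0)%:R)).
  apply: eq_bigr => x _; under eq_bigr do rewrite mulr_sumr.
  rewrite exchange_big /=; apply: eq_bigr => y _.
  exact: sum_quad_char_through_point.
under eq_bigr do rewrite sumrB.
by rewrite sumrB sum_quad_char_plane sum_axes; ring.
Qed.

End HessianSum.

(** With [q = 3 * k + 2], raising [x ^+ 3] to the power [2 * k + 1] gives
    [x ^+ (2 * q - 1) = x]. *)
Lemma finField_cube_inj (F : finFieldType) :
  (#|F| %% 3 = 2)%N -> injective (fun x : F => x ^+ 3).
Proof.
move=> q2; apply: (can_inj (g := fun z => z ^+ (#|F| %/ 3).*2.+1)) => x.
have cardE : #|F| = (3 * (#|F| %/ 3)).+2 by rewrite {1}(divn_eq #|F| 3); lia.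
have := expf_card x; rewrite {1}cardE; set k := (_ %/ 3)%N => xq.
rewrite -exprM.
have -> : (3 * k.*2.+1 = (3 * k).+2 + (3 * k).+1)%N by lia.
by rewrite exprD xq -exprS.
Qed.

Theorem theorem1p10 (p r : nat) (F : finFieldType)
    (p_prime : prime p) (p_gt3 : (3 < p)%N) (r_ge1 : (1 <= r)%N)
    (card_F : #|F| = (p ^ r)%N)
    (q_mod3 : (p ^ r)%N <> 1 %[mod 3]) :
  \sum_(t : F | (t != 0) && (t != 1))
     quad_char (t * (t ^+ 3 - 1)) * (#|hessian_points t|)%:Z = 1.
Proof.
have pF : p \in [pchar F] by exact: card_finPcharP card_F p_prime.
have small_neq0 n : (0 < n < p)%N -> n%:R != 0 :> F.
  by case/andP=> n0 np; rewrite -(dvdn_pcharf pF) gtnNdvd.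
have q_mod3_neq0 : (#|F| %% 3 != 0)%N.
  rewrite card_F -/(dvdn 3 _) Euclid_dvdX // negb_and dvdn_prime2 //.
  by rewrite neq_ltn p_gt3.
have q_mod3_eq2 : (#|F| %% 3 = 2)%N by move: q_mod3; rewrite -card_F; lia.
rewrite -[RHS](sum_quad_char_hessian F); last exact: finField_cube_inj.
- rewrite big_mkcond /=; apply: eq_bigr => t _.
  rewrite natz; case: ifP => // /negbT; rewrite negb_and !negbK.
  case/orP=> /eqP ->; first by rewrite mul0r quad_char0 mul0r.
  by rewrite expr1n subrr mulr0 quad_char0 mul0r.
- by apply: small_neq0; lia.
- by apply: small_neq0; lia.
Qed.
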